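(* Let $g:\{-1,1\}^n\to\{-1,1\}$ be a boolean function such that $\mathrm{Inf}_i(g)\ge\tau$ for at least $n^{\alpha}$ indices $i\in[n]$. Then for any degree-$d$ polynomial threshold function $h:\{-1,1\}^n\to\{-1,1\}$ we have $$\Pr_x[h(x)=g(x)]\le 1-\frac{\tau}{2}+\eta,$$ where $\eta=O\big(d/(\alpha\log n)^{1/8d}\big)$ (with $O(\cdot)$ hiding an absolute constant) and $x$ is uniform on $\{-1,1\}^n$.
   Context: For a boolean function $g:\{-1,1\}^n\to\{-1,1\}$, the influence of variable $i$ is $\mathrm{Inf}_i(g)=\Pr_x[g(x)\neq g(x\oplus e_i)]$ for uniform $x$, where $x\oplus e_i$ denotes $x$ with its $i$-th coordinate flipped. A degree-$d$ polynomial threshold function is a function $h(x)=\mathrm{sgn}(f(x))$ where $f:\{-1,1\}^n\to\mathbb{R}$ is a real polynomial of degree at most $d$. *)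

(* Defs.v *)
From mathcomp Require Import all_boot all_order all_algebra.
From mathcomp Require Import reals exp.
From mathcomp Require Import mpoly.

Set Implicit Arguments.
Unset Strict Implicit.
Unset Printing Implicit Defensive.

Import Order.TTheory GRing.Theory Num.Theory.
Local Open Scope ring_scope.

(* The two-point set {-1,1} is encoded by [bool], with [false] standing for 1
   and [true] for -1; [pm] below is the resulting embedding into the reals. *)
Notation cube n := {ffun 'I_n -> bool}.

Definition pm (R : realType) (b : bool) : R := (-1) ^+ b.

Definition flip (n : nat) (x : cube n) (i : 'I_n) : cube n :=
  [ffun j => if j == i then ~~ x j else x j].

Definition pr (R : realType) (T : finType) (E : {set T}) : R :=
  #|E|%:R / #|T|%:R.

Definition influence (R : realType) (n : nat) (g : cube n -> bool) (i : 'I_n) : R :=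
  pr R [set x : cube n | g x != g (flip x i)].

(* Convention sgn 0 = 1, so that sgn takes its values in {-1,1}; this is why
   [Num.sg] is not used. *)
Definition sgn (R : realType) (t : R) : R := if 0 <= t then 1 else -1.

(* [msize f] is 1 + the total degree of f, and 0 for f = 0. *)
Definition is_PTF (R : realType) (n d : nat) (h : cube n -> bool) : Prop :=
  exists2 f : {mpoly R[n]}, (msize f <= d.+1)%N &
    forall x : cube n, pm R (h x) = sgn f.@[fun i => pm R (x i)].

(* Main.v *)
Require Import Defs.
From mathcomp Require Import all_boot all_order all_algebra.
From mathcomp Require Import reals exp.
From mathcomp Require Import sequences mpoly ring lra.

(** If [g] is sensitive to the flip of coordinate [i] at [x] but [h] is not, then
    [h] errs at [x] or at its neighbour, so
    [Pr[h = g] <= 1 - Inf_i(g)/2 + Inf_i(h)/2], and it suffices to find, among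
    any [m] coordinates, one of small influence on a PTF [h = sgn F].
    Put [h_i = sgn (D_i F)], a PTF of degree [d - 1] that does not depend on
    [x_i]. Then [Inf_i(h) = E[h x_i h_i]], so that by Cauchy-Schwarz the square of
    the total influence over the [m] coordinates is at most
    [E[(sum_i x_i h_i)^2]]. The diagonal contributes [m], and
    [E[x_i x_j h_i h_j] <= (Inf_j(h_i) + Inf_i(h_j)) / 2] off the diagonal. By
    induction on [d] the average influence is at most [2 m^(-1/2^d)], which is
    much smaller than the claimed bound. *)

Import Order.TTheory GRing.Theory Num.Theory.
Local Open Scope ring_scope.

Section CubeFunctions.
Set Implicit Arguments.
Unset Strict Implicit.
Variables (R : realType) (n : nat).
Implicit Types (F G : cube n -> R) (x : cube n) (i j : 'I_n) (S : {set 'I_n}).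

(** * Flips and signs on the cube *)

Lemma flipK i : involutive (fun x => flip x i).
Proof. by move=> x; apply/ffunP => k; rewrite !ffunE; case: eqP => // _; rewrite negbK. Qed.

Lemma flipC x i j : flip (flip x i) j = flip (flip x j) i.
Proof. by apply/ffunP => k; rewrite !ffunE; case: eqP; case: eqP. Qed.

Lemma pm_flip x i : pm R (flip x i i) = - pm R (x i).
Proof. by rewrite ffunE eqxx /pm; case: (x i); rewrite /= ?expr0 ?expr1 ?opprK. Qed.

Lemma pm_flip_neq x i j : j != i -> pm R (flip x i j) = pm R (x j).
Proof. by move=> /negbTE ji; rewrite ffunE ji. Qed.

Lemma pm_case (b : bool) : pm R b = 1 \/ pm R b = -1.
Proof. by rewrite /pm; case: b; rewrite ?expr0 ?expr1; [right|left]. Qed.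

Lemma pm_sqr (b : bool) : pm R b * pm R b = 1.
Proof. by case: (pm_case b) => ->; rewrite ?mulr1 ?mulrNN ?mulr1. Qed.

Lemma sgn_case (t : R) : sgn t = 1 \/ sgn t = -1.
Proof. by rewrite /sgn; case: ifP; [left|right]. Qed.

Lemma eq1N1 : (1 == -1 :> R) = false.
Proof. by apply/eqP; lra. Qed.

Lemma sum_flip F i : \sum_x F x = \sum_x F (flip x i).
Proof. exact: (reindex_inj (inv_inj (flipK i))). Qed.

(** * Discrete derivatives and degree *)

(** Writing [F = x_i A + B] with [A] and [B] free of [x_i], this is [2 A], twice the derivative
    [D_i F]; only its sign matters later. *)
Definition diff i F x : R := pm R (x i) * (F x - F (flip x i)).

Lemma diff_flip i F x : diff i F (flip x i) = diff i F x.
Proof. by rewrite /diff pm_flip flipK; ring. Qed.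

(** Degree via iterated derivatives, level 0 being the constants: an induction on the degree then
    peels off one derivative at a time, without handling polynomials. *)
Fixpoint degree_le (d : nat) F : Prop :=
  if d is e.+1 then forall i, degree_le e (diff i F)
  else forall i x, F (flip x i) = F x.

Lemma degree_le_ext d F G : F =1 G -> degree_le d F -> degree_le d G.
Proof.
elim: d F G => [|d IH] F G FG /= dF i; first by move=> x; rewrite -!FG.
by apply: IH (dF i) => x; rewrite /diff !FG.
Qed.

Lemma degree_le0 d : degree_le d (fun=> 0).
Proof.
elim: d => [|d IH] //= i; apply: degree_le_ext IH => x.
by rewrite /diff subrr mulr0.
Qed.

Lemma degree_leD d F G :
  degree_le d F -> degree_le d G -> degree_le d (fun x => F x + G x).
Proof.
elim: d F G => [|d IH] F G /= dF dG i; first by move=> x; rewrite dF dG.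
by apply: degree_le_ext (IH _ _ (dF i) (dG i)) => x; rewrite /diff; ring.
Qed.

Lemma degree_leZ d (c : R) F : degree_le d F -> degree_le d (fun x => c * F x).
Proof.
elim: d F => [|d IH] F /= dF i; first by move=> x; rewrite dF.
by apply: degree_le_ext (IH _ (dF i)) => x; rewrite /diff; ring.
Qed.

(** Exponents may exceed 1: differencing in [x_i] removes the whole power of [x_i] and leaves the
    factor [1 - (-1)^(m i)]. *)
Lemma degree_le_monomial d (m : 'I_n -> nat) :
  (\sum_i m i <= d)%N -> degree_le d (fun x => \prod_i pm R (x i) ^+ m i).
Proof.
elim: d m => [|d IH] m /= md i.
  move=> x; apply: eq_bigr => k _.
  suff -> : m k = 0%N by rewrite !expr0.
  by move: md; rewrite (bigD1 k) //= leqn0 addn_eq0 => /andP[/eqP].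
pose m' k := if k == i then 0%N else m k.
have step x : diff i (fun y => \prod_k pm R (y k) ^+ m k) x
    = (1 - (-1) ^+ m i) * \prod_k pm R (x k) ^+ m' k.
  have split_i (c : 'I_n -> R) : \prod_k c k = c i * \prod_(k | k != i) c k.
    exact: bigD1.
  rewrite /diff !split_i pm_flip /m' eqxx expr0 mul1r.
  under [in X in _ - X]eq_bigr => k ki do rewrite pm_flip_neq //.
  under [in RHS]eq_bigr => k ki do rewrite (negbTE ki).
  rewrite -mulrBl mulrA; congr (_ * _).
  case: (pm_case (x i)) => ->; rewrite ?opprK ?expr1n ?mul1r //.
  by rewrite mulN1r opprB.
apply: (degree_le_ext (F := fun x => (1 - (-1) ^+ m i) * \prod_k pm R (x k) ^+ m' k)).
  by move=> x; rewrite step.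
(* If [m i = 0] the exponent sum does not drop, but the factor vanishes. *)
have [m0|mi] := posnP (m i).
  apply: degree_le_ext (degree_le0 d) => x.
  by rewrite m0 expr0 subrr mul0r.
apply/degree_leZ/IH; move: md.
rewrite (bigD1 i) //= [in X in _ -> X](bigD1 i) //= {1}/m' eqxx add0n => md.
rewrite (eq_bigr m) => [|k /negbTE ki]; last by rewrite /m' ki.
by rewrite -ltnS; apply: leq_trans md; rewrite -[X in (X < _)%N]add0n ltn_add2r.
Qed.

Lemma degree_le_mpoly d (f : {mpoly R[n]}) :
  (msize f <= d.+1)%N -> degree_le d (fun x => f.@[fun i => pm R (x i)]).
Proof.
move=> df.
apply: (degree_le_ext (F := fun x =>
  \sum_(m <- msupp f) f@_m * \prod_i pm R (x i) ^+ m i)).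
  by move=> x; rewrite mevalE.
have : {in msupp f, forall m : 'X_{1..n}, (mdeg m <= d)%N}.
  by move=> m mf; rewrite -ltnS; apply: leq_trans df; apply: msize_mdeg_lt.
move=> ms; elim: (msupp f : seq 'X_{1..n}) ms => [|m s IH] ms.
  by apply: degree_le_ext (degree_le0 d) => x; rewrite big_nil.
have mono := degree_leZ f@_m (@degree_le_monomial d m _).
apply: degree_le_ext (degree_leD (mono _) (IH _)) => [x||m' m's].
- by rewrite big_cons.
- by rewrite -mdegE ms ?mem_head.
- by rewrite ms // inE m's orbT.
Qed.

(** * Influences of threshold functions *)

Definition num_sensitive i F : R := \sum_x (F x != F (flip x i))%:R.

Lemma num_sensitive_ge0 i F : 0 <= num_sensitive i F.
Proof. exact: sumr_ge0. Qed.

(** Pair [x] with its neighbour: [diff i F] agrees at both and [x_i] changes sign. If [sgn F]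
    differs between them, [x_i * diff i F] has the sign of [F x], so the pair contributes 2;
    otherwise it cancels. *)
Lemma num_sensitive_sgn i F :
  num_sensitive i (fun x => sgn (F x))
  = \sum_(x : cube n) sgn (F x) * (pm R (x i) * sgn (diff i F x)).
Proof.
set B := \sum_x _.
suff : B + B = 2 * num_sensitive i (fun x => sgn (F x)) by lra.
rewrite {2}/B (sum_flip _ i) -big_split /num_sensitive mulr_sumr /=.
apply: eq_bigr => x _; rewrite diff_flip pm_flip /diff.
set a := F x; set b := F (flip x i).
case: (pm_case (x i)) => ->; rewrite /sgn;
  case: (leP 0 a) => a0; case: (leP 0 b) => b0; case: leP => ab0;
  rewrite ?eqxx ?[-1 == 1]eq_sym ?eq1N1 /=; lra.
Qed.

(** Over the four points obtained by flipping [i] and [j], the terms add up to [x_i x_j (sgn F(x) -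
    sgn F(x^j)) (sgn G(x) - sgn G(x^i))]. This is at most 4, and 0 unless both factors are
    sensitive. *)
Lemma correlation_le i j F G : i != j ->
  (forall x, F (flip x i) = F x) -> (forall x, G (flip x j) = G x) ->
  \sum_(x : cube n) (pm R (x i) * sgn (F x)) * (pm R (x j) * sgn (G x))
  <= (num_sensitive j (fun x => sgn (F x)) + num_sensitive i (fun x => sgn (G x))) / 2.
Proof.
move=> ij Fi Gj.
pose T (x : cube n) := (pm R (x i) * sgn (F x)) * (pm R (x j) * sgn (G x)).
have ji : j != i by rewrite eq_sym.
have T4 : 4 * \sum_x T x = \sum_x (T x + T (flip x i) + T (flip x j) + T (flip (flip x j) i)).
  have Tij := etrans (sum_flip T i) (sum_flip (fun x => T (flip x i)) j).
  rewrite !big_split /= -(sum_flip T i) -(sum_flip T j) -Tij.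
  ring.
rewrite -[leLHS]/(\sum_x T x).
suff : 4 * \sum_x T x
  <= 2 * (num_sensitive j (fun x => sgn (F x)) + num_sensitive i (fun x => sgn (G x))).
  lra.
rewrite T4 /num_sensitive -big_split mulr_sumr /=; apply: ler_sum => x _.
rewrite /T !(pm_flip, pm_flip_neq) // !Fi [flip (flip x j) i]flipC !Gj.
case: (pm_case (x i)) => ->; case: (pm_case (x j)) => ->;
case: (sgn_case (F x)) => ->; case: (sgn_case (F (flip x j))) => ->;
case: (sgn_case (G x)) => ->; case: (sgn_case (G (flip x i))) => ->;
  rewrite ?eqxx ?[-1 == 1]eq_sym ?eq1N1 /=; lra.
Qed.

Lemma sum_num_sensitive_le S d F (r : R) : 0 < r -> r <= 1 ->
  1 <= #|S|%:R * r ^+ (2 ^ d) -> degree_le d F ->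
  \sum_(i in S) num_sensitive i (fun x => sgn (F x)) <= 2 * r * #|S|%:R * #|{: cube n}|%:R.
Proof.
elim: d F r => [|d IH] F r r0 r1 Sr dF.
  rewrite big1 ?mulr_ge0 ?ler0n ?(ltW r0) // => i _.
  by apply: big1 => x _; rewrite dF eqxx.
set m : R := #|S|%:R; set N : R := #|{: cube n}|%:R.
pose h i (x : cube n) := pm R (x i) * sgn (diff i F x).
pose G (x : cube n) := \sum_(i in S) h i x.
(* The induction hypothesis is used at radius [r ^+ 2], as [(r^2)^(2^d) = r^(2^(d+1))]. *)
have Sr2 : 1 <= m * (r ^+ 2) ^+ (2 ^ d) by rewrite -exprM -expnS.
have r20 : 0 < r ^+ 2 by rewrite exprn_gt0.
have r21 : r ^+ 2 <= 1 by rewrite expr_le1 // ltW.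
have IHi i := IH (diff i F) (r ^+ 2) r20 r21 Sr2 (dF i).
have m_gt0 : 0 < m.
  by rewrite lt_def ler0n andbT; apply/eqP => m0; move: Sr; rewrite -/m m0 mul0r ler10.
(* This absorbs the diagonal [m * N] into [m^2 r^2 N]. *)
have mr2 : 1 <= m * r ^+ 2.
  apply: le_trans Sr2 _; rewrite ler_pM2l //.
  by rewrite -[leRHS]expr1 ler_wiXn2l ?expn_gt0 // ltW.
set A := \sum_(i in S) _.
have defA : A = \sum_x sgn (F x) * G x.
  rewrite /A (eq_bigr _ (fun i _ => num_sensitive_sgn i F)) exchange_big /=.
  by apply: eq_bigr => x _; rewrite mulr_sumr.
(* The 3 is 1 for the diagonal plus 2 from the induction hypothesis. *)
have G2 : \sum_x G x ^+ 2 <= N * (m ^+ 2 * r ^+ 2 * 3).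
  have -> : \sum_x G x ^+ 2 = \sum_(i in S) \sum_(j in S) \sum_x h i x * h j x.
    under [RHS]eq_bigr => i _ do rewrite exchange_big.
    rewrite exchange_big /=; apply: eq_bigr => x _.
    by rewrite expr2 mulr_suml; apply: eq_bigr => i _; rewrite mulr_sumr.
  pose K i j := num_sensitive j (fun x => sgn (diff i F x)).
  have hij i j : \sum_x h i x * h j x <= (i == j)%:R * N + (K i j + K j i) / 2.
    case: eqVneq => [<-|ij].
      rewrite mul1r -[leLHS]addr0 lerD //.
        rewrite /N -sum1_card natr_sum ler_sum // => x _.
        rewrite mulrACA pm_sqr mul1r; case: (sgn_case (diff i F x)) => ->; lra.
      have := num_sensitive_ge0 i (fun x => sgn (diff i F x)); rewrite /K; lra.
    rewrite mul0r add0r; apply: correlation_le => // x; exact: diff_flip.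
  have Ksum : \sum_(i in S) \sum_(j in S) K i j <= m * (2 * r ^+ 2 * m * N).
    by rewrite /m mulr_natl -sumr_const; apply: ler_sum => i _; exact: IHi.
  apply: (@le_trans _ _ (m * N + \sum_(i in S) \sum_(j in S) K i j)); last first.
    have N0 : 0 <= N by exact: ler0n.
    have : m * N * 1 <= m * N * (m * r ^+ 2) by rewrite ler_wpM2l // mulr_ge0 // ltW.
    nra.
  apply: le_trans (ler_sum _ (fun i _ => ler_sum _ (fun j _ => hij i j))) _.
  under eq_bigr => i _ do rewrite big_split /= -mulr_suml -mulr_suml big_split /=.
  rewrite big_split /= -mulr_suml -mulr_suml big_split /=.
  rewrite [X in (_ + X) / 2]exchange_big /=.
  have -> : \sum_(i in S) \sum_(j in S) (i == j)%:R = m.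
    rewrite /m -sum1_card natr_sum; apply: eq_bigr => i iS.
    rewrite (bigD1 i) //= eqxx big1 ?addr0 // => j /andP[_ /negbTE ji].
    by rewrite eq_sym ji.
  rewrite [X in _ + X / 2](_ : _ = 2 * \sum_(i in S) \sum_(j in S) K i j); first by lra.
  by rewrite mulr_natl mulr2n.
(* Cauchy-Schwarz in linear form, [2 c <s, G> <= <G, G> + c^2 <s, s>], at the
   optimal [c = m * r]. *)
have CS : 2 * (m * r) * A <= \sum_x G x ^+ 2 + (m * r) ^+ 2 * N.
  rewrite defA /N -sum1_card natr_sum !mulr_sumr -big_split /=.
  apply: ler_sum => x _.
  case: (sgn_case (F x)) => ->; rewrite -subr_ge0.
    apply: le_trans (sqr_ge0 (G x - m * r)) _; rewrite le_eqVlt; apply/orP; left; apply/eqP; ring.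
  apply: le_trans (sqr_ge0 (G x + m * r)) _; rewrite le_eqVlt; apply/orP; left; apply/eqP; ring.
(* The constant 2 reproduces itself: [2 m r A <= (3 + 1) m^2 r^2 N]. *)
rewrite -(ler_pM2l (_ : 0 < 2 * (m * r))); last by rewrite !mulr_gt0.
apply: le_trans CS _; apply: le_trans (lerD G2 (lexx _)) _.
rewrite le_eqVlt; apply/orP; left; apply/eqP; ring.
Qed.

End CubeFunctions.

(** * From counts to probabilities *)

Lemma card_cube_gt0 (R : realType) (n : nat) : (0 : R) < #|{: cube n}|%:R.
Proof. by rewrite ltr0n; apply/card_gt0P; exists [ffun=> false]. Qed.

Lemma pr_sum (R : realType) (n : nat) (P : pred (cube n)) :
  pr R [set x | P x] * #|{: cube n}|%:R = \sum_x (P x)%:R.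
Proof.
rewrite /pr divfK ?gt_eqF ?card_cube_gt0 // -sum1_card natr_sum big_mkcond /=.
by apply: eq_bigr => x _; rewrite inE; case: (P x).
Qed.

Lemma influence_le1 (R : realType) (n : nat) (h : cube n -> bool) i :
  influence R h i <= 1.
Proof.
by rewrite /influence /pr ler_pdivrMr ?card_cube_gt0 // mul1r ler_nat max_card.
Qed.

Lemma agreement_le (R : realType) (n : nat) (g h : cube n -> bool) i :
  pr R [set x | h x == g x] <= 1 - influence R g i / 2 + influence R h i / 2.
Proof.
have N0 := card_cube_gt0 R n.
(* Agreement is counted at both [x] and its neighbour, which makes the inequality pointwise. *)
suff : 2 * \sum_(x : cube n) (h x == g x)%:R <= 2 * #|{: cube n}|%:R
    - \sum_x (g x != g (flip x i))%:R + \sum_x (h x != h (flip x i))%:R :> R.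
  rewrite -!pr_sum -/(influence R g i) -/(influence R h i) => le2.
  rewrite -(ler_pM2r N0); lra.
rewrite mulr_natl mulr2n {2}(sum_flip (fun x => (h x == g x)%:R) i).
rewrite -sum1_card natr_sum mulr_sumr -sumrN -!big_split /=.
apply: ler_sum => x _.
case: (h x); case: (g x); case: (h (flip x i)); case: (g (flip x i)) => /=; lra.
Qed.

(* The radius [r] stands for [|S|^(-1/2^d)]; stating it as a free parameter
   avoids real exponents. *)
Lemma PTF_small_influence (R : realType) (n d : nat) (h : cube n -> bool)
    (S : {set 'I_n}) (r : R) : is_PTF R d h -> 0 < r -> r <= 1 ->
  1 <= #|S|%:R * r ^+ (2 ^ d) -> exists2 i, i \in S & influence R h i <= 2 * r.
Proof.
move=> [f fd hf] r0 r1 Sr.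
have N0 := card_cube_gt0 R n.
have [/exists_inP//|] := boolP [exists i in S, influence R h i <= 2 * r].
rewrite negb_exists_in => /forall_inP big_inf.
have := sum_num_sensitive_le r0 r1 Sr (degree_le_mpoly fd).
have infE i : num_sensitive i (fun x => sgn f.@[fun i => pm R (x i)])
    = influence R h i * #|{: cube n}|%:R.
  rewrite /influence pr_sum; apply: eq_bigr => x _; rewrite -!hf.
  by rewrite /pm; case: (h x); case: (h _);
    rewrite ?eqxx ?expr0 ?expr1 ?[-1 == 1]eq_sym ?eq1N1.
rewrite (eq_bigr _ (fun i _ => infE i)) -mulr_suml ler_pM2r // leNgt => /negP[].
(* A nonempty [S] makes the summed inequality strict. *)
have /card_gt0P[i iS] : (0 < #|S|)%N.
  by rewrite lt0n; apply/eqP => S0; move: Sr; rewrite S0 mul0r ler10.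
rewrite mulr_natr -sumr_const; apply: ltr_sum => [|j jS]; last by rewrite ltNge big_inf.
by apply/hasP; exists i => //; exact: mem_index_enum.
Qed.

Theorem theorem1p2 (R : realType) :
  exists2 C : R, 0 < C &
    forall (n d : nat) (alpha tau : R) (g : cube n -> bool),
      (1 < n)%N -> (0 < d)%N -> 0 < alpha ->
      n%:R `^ alpha <= #|[set i : 'I_n | (tau <= influence R g i)%R]|%:R ->
      forall h : cube n -> bool,
        is_PTF R d h ->
        pr R [set x : cube n | h x == g x] <=
          1 - tau / 2%:R
            + C * (d%:R / (alpha * ln n%:R) `^ (1 / (8 * d)%:R)).
Proof.
exists 1 => // n d alpha tau g n1 d0 alpha0; set S := [set i | _] => nS h hd.
rewrite mul1r.
set L := alpha * ln n%:R; set t := L `^ _.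
have L0 : 0 < L by rewrite mulr_gt0 // ln_gt0 // ltr1n.
have t0 : 0 < t by exact: powR_gt0.
have tL : t ^+ (8 * d) = L.
  rewrite /t -powR_mulrn ?powR_ge0 // -powRrM div1r mulVf ?powRr1 ?ltW //.
  by rewrite pnatr_eq0 muln_eq0 /= -lt0n.
have d1 : 1 <= d%:R :> R by rewrite ler1n.
have SL : expR L <= #|S|%:R.
  apply: le_trans nS; by rewrite /powR pnatr_eq0 gtn_eqF // ltnW.
have suff_i i (r : R) : i \in S -> influence R h i <= 2 * r -> r <= d%:R / t ->
    pr R [set x | h x == g x] <= 1 - tau / 2 + d%:R / t.
  rewrite inE => gi hi rt; have := agreement_le R g h i; lra.
(* For [t <= 2] the error term is at least 1/2, and the trivial bound [Inf_i(h) <= 1] suffices. *)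
have [t2|t2] := leP t 2.
  have /card_gt0P[i iS] : (0 < #|S|)%N.
    by rewrite -(ltr0n R); apply: lt_le_trans SL; exact: expR_gt0.
  apply: (suff_i i (1 / 2) iS); first by have := influence_le1 R h i; lra.
  by rewrite ler_pdivlMr //; lra.
have ti1 : t^-1 <= 1 by rewrite invf_le1 //; lra.
have t1 : 1 <= t by lra.
(* The radius [1 / t] is admissible once [t^(2^d) <= |S|]. *)
case: (@PTF_small_influence R n d h S t^-1 hd _ ti1); rewrite ?invr_gt0 //; last first.
  move=> i iS hi; apply: (suff_i i t^-1 iS hi).
  by rewrite ler_pdivlMr // mulVf // gt_eqF.
rewrite exprVn ler_pdivlMr ?exprn_gt0 // mul1r; apply: le_trans SL.
(* By [e^y >= 1 + y] at [y = L / 2^d], it is enough that [t * 2^d <= L = t^(8d)]; since [t >= 2],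
   the left side is at most [t^(d+1)]. *)
have -> : L = L / (2 ^ d)%:R * (2 ^ d)%:R.
  by rewrite divfK // pnatr_eq0 expn_eq0.
rewrite expRM_natr lerXn2r ?nnegrE ?expR_ge0 ?(ltW t0) //.
apply: le_trans (expR_ge1Dx _); apply: ler_wpDl => //.
rewrite ler_pdivlMr ?ltr0n ?expn_gt0 // natrX -tL.
apply: (@le_trans _ _ (t * t ^+ d)).
  by rewrite ler_pM2l // lerXn2r ?nnegrE ?ltW.
by rewrite -exprS ler_weXn2l // mulSn -addn1 leq_add2l muln_gt0.
Qed.
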